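(* Let $G$ be a graph on $n\ge 2$ vertices with $m\ge1$ edges whose line graph is $r$-regular. Then $G$ is eligible and $$\operatorname{mv}(G) = \frac{m(4+r)}{n-1} - \left(\frac{2m}{n-1}\right)^2.$$
   Context: Graphs are finite and simple. For a graph $G$ on $n$ vertices, $\mathcal{S}_L(G)$ denotes the set of $n\times n$ real symmetric matrices $A=[a_{i,j}]$ such that $a_{i,j}<0$ if $\{i,j\}\in E(G)$, $a_{i,j}=0$ if $i\neq j$ and $\{i,j\}\notin E(G)$, and $a_{i,i}=-\sum_{k\neq i}a_{i,k}$ for all $i$. Let $\mathcal{S}^s_L(G)=\{A\in\mathcal{S}_L(G):\operatorname{tr}(A)=2|E(G)|\}$. For $A\in\mathcal{S}_L(G)$ with spectrum $\{0,\lambda_2,\ldots,\lambda_n\}$ put $\mathbb{E}(A)=\frac{1}{n-1}\sum_{i=2}^n\lambda_i$ and $\operatorname{Var}(A)=\frac{1}{n-1}\sum_{i=2}^n(\lambda_i-\mathbb{E}(A))^2$. The minimum variance of $G$ is $\operatorname{mv}(G)=\inf\{\operatorname{Var}(A):A\in\mathcal{S}^s_L(G)\}$. The line graph of $G$ has vertex set $E(G)$, two distinct edges being adjacent when they share a vertex. Let $M_2=4I+B$, where $B$ is the adjacency matrix of the line graph of $G$ ($M_2$ is positive definite). $G$ is called eligible if $M_2^{-1}\mathbf{1}$ is entrywise positive, where $\mathbf{1}$ is the all-ones vector. *)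

(* Defs.v *)
From mathcomp Require Import all_boot all_order all_algebra.
From mathcomp Require Import boolp classical_sets reals.
Set Implicit Arguments.
Unset Strict Implicit.
Unset Printing Implicit Defensive.
Import Order.TTheory GRing.Theory Num.Theory.
Local Open Scope ring_scope.

Record sgraph (V : finType) := SGraph {
  adj :> rel V;
  adj_sym : symmetric adj;
  adj_irrefl : irreflexive adj
}.

Definition edges (V : finType) (G : sgraph V) : {set {set V}} :=
  [set [set u.1; u.2] | u : V * V & adj G u.1 u.2]%SET.

Definition regular (V : finType) (G : sgraph V) (r : nat) : Prop :=
  forall v : V, #|[set w | adj G v w]%SET| = r.

Definition edge_type (V : finType) (G : sgraph V) : finType :=
  {e : {set V} | e \in edges G}.

Section LineGraph.
Variables (V : finType) (G : sgraph V).

Definition line_adj : rel (edge_type G) :=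
  fun e f => (e != f) && (val e :&: val f != finset.set0)%SET.

Fact line_adj_sym : symmetric line_adj.
Proof. by move=> e f; rewrite /line_adj eq_sym finset.setIC. Qed.

Fact line_adj_irrefl : irreflexive line_adj.
Proof. by move=> e; rewrite /line_adj eqxx. Qed.

Definition line_graph : sgraph (edge_type G) :=
  SGraph line_adj_sym line_adj_irrefl.
End LineGraph.

Definition adj_mx (R : realType) (V : finType) (H : sgraph V) : 'M[R]_#|V| :=
  \matrix_(i, j) (adj H (enum_val i) (enum_val j))%:R.

Definition M2 (R : realType) (V : finType) (G : sgraph V) :
    'M[R]_#|edge_type G| :=
  4%:R%:M + adj_mx R (line_graph G).

(* [invmx] is a genuine inverse only on units; see [M2_unit] below. *)
Definition eligible (R : realType) (V : finType) (G : sgraph V) : Prop :=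
  forall i, 0 < (invmx (M2 R G) *m (const_mx 1 : 'cV[R]_#|edge_type G|)) i 0.

Section MinimumVariance.
Variables (R : realType) (n : nat).
Implicit Types (A : 'M[R]_n) (G : sgraph 'I_n).

Definition SL G : set 'M[R]_n := [set A |
  [/\ A^T = A,
      forall i j, adj G i j -> A i j < 0,
      forall i j, i != j -> ~~ adj G i j -> A i j = 0 &
      forall i, A i i = - \sum_(k | k != i) A i k]]%classic.

Definition SLs G : set 'M[R]_n := [set A |
  SL G A /\ \tr A = 2 * #|edges G|%:R]%classic.

(* The eigenvalues with multiplicity, in an unspecified order. The default
   [::] is reached only if the characteristic polynomial does not split over R,
   which does not happen for symmetric matrices. *)
Definition spectrum A : seq R :=
  xget [::] [set s : seq R | char_poly A = \prod_(x <- s) ('X - x%:P)]%classic.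

(* lambda_2, ..., lambda_n: one copy of the eigenvalue 0 is removed. *)
Definition spectrum2 A : seq R := rem 0 (spectrum A).

Definition mean A : R := (\sum_(x <- spectrum2 A) x) / (n%:R - 1).

Definition variance A : R :=
  (\sum_(x <- spectrum2 A) (x - mean A) ^+ 2) / (n%:R - 1).

Definition mv G : R := inf [set variance A | A in SLs G]%classic.
End MinimumVariance.

Section M2Unit.
Variables (R : realType) (V : finType) (G : sgraph V).

Let N : 'M[R]_(#|edge_type G|, #|V|) :=
  \matrix_(a, x) ((enum_val x : V) \in val (enum_val a : edge_type G))%:R.

Let card_edge (e : edge_type G) : #|val e| = 2%N.
Proof.
case: e => e /= /finset.imsetP[[x y] /=]; rewrite inE /= => xy ->.
by rewrite cards2; case: eqVneq xy => // ->; rewrite adj_irrefl.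
Qed.

Let M2E : M2 R G = 2%:R%:M + N *m N^T.
Proof.
apply/matrixP => a b; rewrite !mxE.
have -> : \sum_j N a j * N^T j b =
    #|(val (enum_val a) :&: val (enum_val b))%SET|%:R.
  rewrite -sum1_card natr_sum [RHS]big_mkcond /= [RHS](reindex (@enum_val V V)) /=;
    last by apply: onW_bij; exact: enum_val_bij.
  apply: eq_bigr => j _; rewrite !mxE inE.
  by case: (_ \in _); case: (_ \in _); rewrite /= ?mulr0 ?mul0r ?mulr1.
rewrite /= /line_adj; have [->|ab] := eqVneq a b.
  by rewrite eqxx /= finset.setIid card_edge !mulr1n addr0 -natrD.
rewrite !mulr0n !add0r (inj_eq enum_val_inj) ab /=.
set e := enum_val a; set f := enum_val b.
have ef : e != f by rewrite (inj_eq enum_val_inj).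
have [->|] := eqVneq (val e :&: val f)%SET finset.set0; first by rewrite cards0.
rewrite -card_gt0 /= => I0; congr (_%:R); apply/eqP; rewrite eqn_leq I0 /=.
rewrite leqNgt; apply: contra ef => I2.
have Ie : (val e :&: val f)%SET = val e.
  by apply/eqP; rewrite eqEcard finset.subsetIl card_edge.
have If : (val e :&: val f)%SET = val f.
  by apply/eqP; rewrite eqEcard finset.subsetIr card_edge.
by apply/eqP/val_inj; rewrite -Ie If.
Qed.

Lemma M2_unit : M2 R G \in unitmx.
Proof.
rewrite -row_free_unit -kermx_eq0; apply/eqP/row_matrixP => i; rewrite row0.
set v := row i _.
have v0 : v *m M2 R G = 0 by apply/sub_kermxP; exact: row_sub.
have sq k (w : 'rV[R]_k) : (w *m w^T) 0 0 = \sum_j w 0 j ^+ 2.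
  by rewrite mxE; apply: eq_bigr => j _; rewrite mxE expr2.
have : (v *m M2 R G *m v^T) 0 0 = 0 by rewrite v0 mul0mx mxE.
rewrite M2E mulmxDr mul_mx_scalar mulmxDl -scalemxAl mxE [X in X + _]mxE mulmxA.
rewrite -mulmxA -trmx_mul !sq => /eqP.
have s0 k (w : 'rV[R]_k) : 0 <= \sum_j w 0 j ^+ 2.
  by apply: sumr_ge0 => j _; exact: sqr_ge0.
rewrite paddr_eq0 ?mulr_ge0 ?s0 ?ler0n // mulf_eq0 pnatr_eq0 /= => /andP[vv _].
apply/rowP => j; rewrite [RHS]mxE; apply/eqP; rewrite -sqrf_eq0.
by move: vv; rewrite psumr_eq0 => [/allP/(_ j)|k _]; rewrite ?mem_index_enum ?sqr_ge0 //; apply.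
Qed.
End M2Unit.

(* Main.v *)
Require Import Defs.
From mathcomp Require Import all_boot all_order all_algebra.
From mathcomp Require Import boolp classical_sets reals.
From mathcomp Require Import complex.
From mathcomp Require Import ring lra.
Set Implicit Arguments.
Unset Strict Implicit.
Unset Printing Implicit Defensive.
Import Order.TTheory GRing.Theory Num.Theory.
Local Open Scope ring_scope.

(** Eligibility is immediate: every row of [M2] sums to [4 + r], so
    [M2^-1 1 = (4 + r)^-1 1].

    For the minimum variance, a matrix [A] of [SLs G] is symmetric and kills the
    all-ones vector. Its spectrum is therefore real and contains [0], so that
    the sums of the [lambda_i] and of their squares over [i >= 2] are [\tr A]
    and [\tr (A *m A)]; this gives
    [variance A = \tr (A *m A) / (n - 1) - (\tr A / (n - 1)) ^+ 2]
    ([variance_trace]). As [\tr A = 2 m] is prescribed, minimizing the variance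
    amounts to minimizing the squared Frobenius norm [\tr (A *m A)].

    The minimizer is the combinatorial Laplacian [L]. A line graph is
    [r]-regular when [degree x + degree y = r + 2] for every edge [xy]; summing
    over the edges yields [2 \tr (L *m A) = (4 + r) \tr A] for every [A] in
    [SL G] ([mxtrace_laplacianM]). So the Frobenius inner product of [L] with
    [A] is constant on [SLs G], with value [(4 + r) m], which is also
    [\tr (L *m L)] since [L] itself lies in [SLs G]. Hence [L] is the foot of
    the perpendicular from the origin to [SLs G]: expanding
    [0 <= \tr ((A - L) *m (A - L))] gives
    [\tr (A *m A) >= (4 + r) m = \tr (L *m L)]. *)

(** * The spectrum of a real symmetric matrix *)

Lemma mxtrace_conj (F : fieldType) n (P D : 'M[F]_n) :
  P \in unitmx -> \tr (invmx P *m D *m P) = \tr D.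
Proof. by move=> Pu; rewrite mxtrace_mulC mulmxA mulmxV // mul1mx. Qed.

Lemma char_poly_conj (F : fieldType) n (P D : 'M[F]_n) :
  P \in unitmx -> char_poly (invmx P *m D *m P) = char_poly D.
Proof.
move=> Pu; have PP : map_mx polyC (invmx P) *m map_mx polyC P = 1%:M.
  by rewrite -map_mxM mulVmx // map_mx1.
have -> : char_poly (invmx P *m D *m P) =
    \det (map_mx polyC (invmx P) *m char_poly_mx D *m map_mx polyC P).
  congr (\det _); rewrite /char_poly_mx mulmxBr mulmxBl !map_mxM.
  by rewrite mul_mx_scalar -scalemxAl PP scalemx1.
by rewrite !det_mulmx mulrAC -det_mulmx PP det1 mul1r.
Qed.

(** The spectral theorem for Hermitian matrices over [R[i]] provides a real
    diagonal form [d] of [A]; its real parts are the roots of the characteristic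
    polynomial over [R], and the two traces are read on the diagonal form. *)
Lemma sym_char_poly_split (R : rcfType) n (A : 'M[R]_n) : A^T = A ->
  exists s : seq R, [/\ char_poly A = \prod_(x <- s) ('X - x%:P),
    size s = n, \sum_(x <- s) x = \tr A & \sum_(x <- s) x ^+ 2 = \tr (A *m A)].
Proof.
move=> symA; pose toC : {rmorphism R -> R[i]} := real_complex R.
pose B := map_mx toC A; pose P := spectralmx B; pose d := spectral_diag B.
have hermB : B \is hermsymmx.
  apply: realsym_hermsym.
    by apply/is_hermitianmxP; rewrite expr0 scale1r map_mx_id // /B map_trmx symA.
  by apply/mxOverP => i j; rewrite !mxE; apply/complex_realP; exists (A i j).
have BE : B = invmx P *m diag_mx d *m P.
  exact/orthomx_spectralP/hermitian_normalmx.
have Pu : P \in unitmx := spectral_unit B.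
have dE i : toC (complex.Re (d 0 i)) = d 0 i.
  by apply: RRe_real; have /mxOverP := hermitian_spectral_diag_real hermB; apply.
have toCI : injective toC := fmorph_inj toC.
exists [seq complex.Re (d 0 i) | i <- enum 'I_n]; split.
- apply: (map_poly_inj toC); rewrite map_char_poly -/B BE char_poly_conj //.
  rewrite char_poly_trig ?diag_mx_is_trig // rmorph_prod big_map big_enum /=.
  apply: eq_bigr => i _.
  by rewrite rmorphB /= map_polyX map_polyC /= dE !mxE eqxx.
- by rewrite size_map size_enum_ord.
- apply: toCI; rewrite -trace_map_mx -/B BE mxtrace_conj // mxtrace_diag.
  by rewrite rmorph_sum big_map big_enum; apply: eq_bigr => i _.
apply: toCI; rewrite -trace_map_mx map_mxM -/B BE.
have -> : invmx P *m diag_mx d *m P *m (invmx P *m diag_mx d *m P) =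
    invmx P *m (diag_mx d *m diag_mx d) *m P.
  by rewrite !mulmxA mulmxK.
rewrite mxtrace_conj // mulmx_diag mxtrace_diag rmorph_sum big_map big_enum.
by apply: eq_bigr => i _; rewrite rmorphXn /= dE mxE expr2.
Qed.

(** Dropping one eigenvalue [0] changes neither the sum of the eigenvalues nor
    that of their squares, and leaves [n - 1] terms, which matches the
    normalization by [n - 1] in the mean and the variance. *)
Lemma variance_trace (R : realType) n (A : 'M[R]_n) : (2 <= n)%N ->
  A^T = A -> root (char_poly A) 0 ->
  variance A = \tr (A *m A) / (n%:R - 1) - (\tr A / (n%:R - 1)) ^+ 2.
Proof.
move=> n2 symA rootA; have [s [splitA sz tr1 tr2]] := sym_char_poly_split symA.
(* The factorization into linear factors is unique up to order, so the choice
   made in [spectrum] is irrelevant. *)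
have eq_s : perm_eq (spectrum A) s.
  apply: prod_XsubC_eq; rewrite -splitA; symmetry.
  rewrite /spectrum; case: xgetP => [_ ->|/(_ s)] //; by case.
have s0 : 0 \in spectrum A.
  by rewrite (perm_mem eq_s) -root_prod_XsubC -splitA.
have sumE (F : R -> R) : F 0 + \sum_(x <- spectrum2 A) F x = \sum_(x <- s) F x.
  by rewrite -(perm_big _ eq_s) (perm_big _ (perm_to_rem s0)) big_cons.
have sz2 : (size (spectrum2 A))%:R = n%:R - 1 :> R.
  rewrite size_rem // (perm_size eq_s) sz -subn1 natrB //; exact: ltnW.
have n1 : n%:R - 1 != 0 :> R by rewrite subr_eq0 pnatr_eq1 gtn_eqF.
have sum1 := sumE id; have sum2 := sumE (fun x => x ^+ 2).
rewrite /= tr1 add0r in sum1; rewrite /= tr2 expr0n add0r in sum2.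
rewrite /variance.
have -> : \sum_(x <- spectrum2 A) (x - mean A) ^+ 2 =
    \tr (A *m A) - mean A *+ 2 * \tr A + mean A ^+ 2 * (n%:R - 1).
  rewrite -sum1 -sum2 -sz2 mulr_sumr -sumrN -sum1_size natr_sum mulr_sumr.
  rewrite -!big_split /=; apply: eq_bigr => x _; ring.
rewrite /mean sum1; field; exact: n1.
Qed.

(** * Degrees in a graph and in its line graph *)
Section Degrees.
Variables (V : finType) (G : sgraph V).
Implicit Types (x y : V) (e f : {set V}).

Definition degree x := #|[set y | adj G x y]%SET|.

Lemma edgesP e : reflect (exists x y, adj G x y /\ e = [set x; y]%SET) (e \in edges G).
Proof.
apply: (iffP finset.imsetP) => [[[x y]]|[x [y [xy ->]]]].
  by rewrite inE => xy ->; exists x, y.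
by exists (x, y); rewrite ?inE.
Qed.

Lemma card_edge e : e \in edges G -> #|e| = 2%N.
Proof.
move=> /edgesP[x [y [xy ->]]]; rewrite cards2.
by case: eqVneq xy => // ->; rewrite adj_irrefl.
Qed.

Lemma card_incident x : #|[set f in edges G | x \in f]%SET| = degree x.
Proof.
rewrite /degree -[RHS](card_in_imset (f := fun y => [set x; y]%SET)) => [|y z]; last first.
  rewrite !inE => xy xz /setP/(_ y); rewrite !inE eqxx orbT.
  by case: eqVneq xy => [->|_ _]; rewrite ?adj_irrefl //= => /esym/eqP.
apply: eq_card => f; rewrite inE; apply/andP/finset.imsetP => [[]|[y + ->]].
  move=> /edgesP[y [z [yz ->]]]; rewrite !inE => /orP[]/eqP->.
    by exists z; rewrite ?inE.
  by exists y; rewrite ?inE 1?adj_sym // finset.setUC.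
by rewrite inE => xy; rewrite !inE eqxx; split => //; apply/edgesP; exists x, y.
Qed.

(** Double counting of the pairs [(x, f)] with [x] in both [e] and the edge [f].
    With [e] the whole vertex set this is the handshake lemma; with [e] an edge
    it gives the degree of [e] in the line graph. *)
Lemma sum_degree e :
  (\sum_(x in e) degree x = \sum_(f in edges G) #|e :&: f|)%N.
Proof.
under eq_bigr => x _ do rewrite -card_incident -sum1_card.
under [RHS]eq_bigr => f _ do rewrite -sum1_card.
rewrite (exchange_big_dep (mem (edges G))) /= => [|x f _]; last by rewrite inE => /andP[].
by apply: eq_bigr => f fG; apply: eq_bigl => x; rewrite !inE fG.
Qed.

Lemma handshake : (\sum_x degree x = 2 * #|edges G|)%N.
Proof.
rewrite (eq_bigl (mem [set: V]%SET)) => [|x]; last by rewrite /= inE.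
rewrite sum_degree mulnC -sum_nat_const; apply: eq_bigr => f fG.
by rewrite finset.setTI card_edge.
Qed.

Lemma card_edgeI e f : e \in edges G -> f \in edges G -> e != f ->
  #|e :&: f|%SET = (e :&: f != finset.set0)%SET :> nat.
Proof.
move=> eG fG ef.
have [->|] := eqVneq (e :&: f)%SET finset.set0; first by rewrite cards0.
rewrite -card_gt0 => I0; apply/eqP; rewrite eqn_leq I0 andbT leqNgt /=.
apply: contra ef => I2; rewrite eqEcard !card_edge // leqnn andbT.
have /eqP<- : (e :&: f)%SET == e by rewrite eqEcard finset.subsetIl card_edge.
exact: finset.subsetIr.
Qed.

(** In [sum_degree] for an edge [e], the term [f = e] contributes [2] and each
    neighbour of [e] in the line graph contributes [1]. *)
Lemma edge_degree r x y : regular (line_graph G) r -> adj G x y ->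
  (degree x + degree y = r + 2)%N.
Proof.
move=> reg xy; have nxy : x != y by apply: contraL xy => /eqP->; rewrite adj_irrefl.
have eG : [set x; y]%SET \in edges G by apply/edgesP; exists x, y.
pose e : edge_type G := Sub [set x; y]%SET eG.
have <- : (\sum_(z in [set x; y]%SET) degree z = degree x + degree y)%N.
  by rewrite big_setU1 ?big_set1 // inE.
rewrite sum_degree (bigD1 _ eG) /= finset.setIid card_edge // addnC; congr addn.
rewrite -(reg e) -sum1_card big_mkcondr big_sub [RHS]big_mkcond /=.
apply: eq_bigr => f _; rewrite inE /= /line_adj -(inj_eq val_inj e f) /= eq_sym.
by case: ifP => //= ef; rewrite card_edgeI ?(valP f) //.
Qed.
End Degrees.

Lemma row_sum_M2 (R : realType) (V : finType) (G : sgraph V) r :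
  regular (line_graph G) r ->
  M2 R G *m const_mx 1 = (4 + r%:R) *: (const_mx 1 : 'cV_#|edge_type G|).
Proof.
move=> reg; apply/colP => i.
rewrite mulmxDl mul_scalar_mx !mxE !mulr1; congr (_ + _).
rewrite -(reg (enum_val i)) -sum1_card natr_sum [RHS]big_mkcond /=.
rewrite [RHS](reindex (@enum_val (edge_type G) (edge_type G))) /=; last first.
  by apply: onW_bij; exact: enum_val_bij.
by apply: eq_bigr => j _; rewrite !mxE mulr1 inE; case: ifP => /= ->.
Qed.

Lemma line_regular_eligible (R : realType) (V : finType) (G : sgraph V) r :
  regular (line_graph G) r -> eligible R G.
Proof.
move=> reg i; have r4 : 0 < 4 + r%:R :> R by rewrite ltr_pwDl ?ler0n.
have -> : const_mx 1 = (4 + r%:R)^-1 *: (M2 R G *m (const_mx 1 : 'cV_#|edge_type G|)).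
  by rewrite (row_sum_M2 _ reg) scalerA mulVf ?scale1r // gt_eqF.
by rewrite -scalemxAr mulKmx ?M2_unit // !mxE mulr1 invr_gt0.
Qed.

(** * Trace identities for generalized Laplacians *)
Section Laplacian.
Variables (R : realType) (n : nat) (G : sgraph 'I_n).
Implicit Types (A : 'M[R]_n).

Definition laplacian : 'M[R]_n :=
  \matrix_(i, j) if i == j then (degree G i)%:R else - (adj G i j)%:R.

Lemma mxtrace_laplacian : \tr laplacian = 2 * #|edges G|%:R.
Proof.
rewrite -natrM -handshake natr_sum; apply: eq_bigr => i _.
by rewrite mxE eqxx.
Qed.

Lemma laplacian_SL : SL G laplacian.
Proof.
split=> [|i j ij|i j ij nadj|i].
- by apply/matrixP => i j; rewrite !mxE eq_sym adj_sym; case: eqVneq => // ->.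
- rewrite mxE; case: eqVneq ij => [->|_ ->]; first by rewrite adj_irrefl.
  by rewrite oppr_lt0.
- by rewrite mxE (negbTE ij) (negbTE nadj) oppr0.
rewrite mxE eqxx -sumrN /degree -sum1_card natr_sum big_mkcond /=.
rewrite (bigD1 i) //= inE adj_irrefl add0r; apply: eq_bigr => k ki.
by rewrite inE mxE eq_sym (negbTE ki) opprK; case: (adj _ _ _).
Qed.

(** The rows of [A] sum to zero and [A] is symmetric, so the all-ones row vector
    is a left eigenvector for the eigenvalue [0]. *)
Lemma SL_root0 A : (0 < n)%N -> SL G A -> root (char_poly A) 0.
Proof.
move=> n0 [symA _ _ rowA]; rewrite -eigenvalue_root_char; apply/eigenvalueP.
exists (const_mx 1); last first.
  by apply/eqP => /rowP/(_ (Ordinal n0))/eqP; rewrite !mxE oner_eq0.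
apply/rowP => i; rewrite scale0r !mxE (bigD1 i) //= mxE mul1r rowA addrC.
apply/eqP; rewrite subr_eq0; apply/eqP; apply: eq_bigr => j _.
by rewrite mxE mul1r -{1}symA mxE.
Qed.

(** Since [A] vanishes off the edges and its rows sum to zero, the [i]-th
    diagonal entry of [L *m A] is [(degree i + 1) * A i i]. Replacing [A i i] by
    the off-diagonal entries and symmetrizing in [i, j], each edge [ij] gets the
    weight [degree i + degree j + 2 = r + 4]. *)
Lemma mxtrace_laplacianM r A : regular (line_graph G) r -> SL G A ->
  2 * \tr (laplacian *m A) = (4 + r%:R) * \tr A.
Proof.
move=> reg [symA _ offA rowA].
have symE i j : A i j = A j i by rewrite -{1}symA mxE.
have -> : \tr (laplacian *m A) = \sum_i ((degree G i)%:R + 1) * A i i.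
  apply: eq_bigr => i _; rewrite mxE (bigD1 i) //= !mxE eqxx mulrDl mul1r.
  congr (_ + _); rewrite rowA -sumrN; apply: eq_bigr => j ji.
  rewrite mxE eq_sym (negbTE ji) symE mulNr; congr (- _).
  by case: (boolP (adj G i j)) => ij; rewrite ?mul1r // offA ?mulr0 // eq_sym.
have diagE (F : 'I_n -> R) :
    \sum_i F i * A i i = - \sum_i \sum_(j | j != i) F i * A i j.
  rewrite -sumrN; apply: eq_bigr => i _.
  by rewrite rowA mulrN mulr_sumr.
have -> : (4 + r%:R) * \tr A = \sum_i (4 + r%:R) * A i i by rewrite mulr_sumr.
(* Doubling the left-hand side and exchanging the sums in one copy pairs the
   weight of [i] with that of [j] on each entry [A i j]. *)
rewrite !diagE mulrN; congr (- _); rewrite mulr_natl mulr2n.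
rewrite [X in _ + X](exchange_big_dep xpredT) //= -big_split /=.
apply: eq_bigr => i _.
rewrite [X in _ + X](eq_bigl (fun j => j != i)) => [|j]; last by rewrite eq_sym.
rewrite -big_split /=; apply: eq_bigr => j ji; rewrite (symE j i) -mulrDl.
case: (boolP (adj G i j)) => [ij|nij]; last by rewrite offA ?mulr0 // eq_sym.
have /(congr1 (fun k => k%:R : R)) := edge_degree reg ij; rewrite !natrD => E.
by congr (_ * _); lra.
Qed.

Lemma mxtrace_sqr_ge0 A : A^T = A -> 0 <= \tr (A *m A).
Proof.
move=> symA; apply: sumr_ge0 => i _; rewrite mxE; apply: sumr_ge0 => j _.
by rewrite -{2}symA mxE -expr2 sqr_ge0.
Qed.

Lemma mxtrace_laplacian_sqr r : regular (line_graph G) r ->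
  \tr (laplacian *m laplacian) = #|edges G|%:R * (4 + r%:R).
Proof.
move=> reg; have := mxtrace_laplacianM reg laplacian_SL.
rewrite mxtrace_laplacian; nra.
Qed.

(** [A - L] is orthogonal to [L] for the Frobenius inner product, so this is
    Pythagoras: [\tr (A *m A) = \tr (L *m L) + \tr ((A - L) *m (A - L))]. *)
Lemma mxtrace_sqr_ge r A : regular (line_graph G) r -> SLs G A ->
  #|edges G|%:R * (4 + r%:R) <= \tr (A *m A).
Proof.
move=> reg [SLA trA]; have [symA _ _ _] := SLA; have [symL _ _ _] := laplacian_SL.
have : 0 <= \tr ((A - laplacian) *m (A - laplacian)).
  by apply: mxtrace_sqr_ge0; rewrite linearB /= symA symL.
rewrite mulmxBl !mulmxBr !raddfB /= (mxtrace_mulC A laplacian).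
rewrite (mxtrace_laplacian_sqr reg).
have := mxtrace_laplacianM reg SLA; rewrite trA; nra.
Qed.
End Laplacian.

Theorem proposition4p7 (R : realType) (n m r : nat) (G : sgraph 'I_n)
    (hn : (2 <= n)%N) (hm : (1 <= m)%N) (hG : #|edges G| = m)
    (hr : regular (line_graph G) r) :
  eligible R G /\
  mv R G = m%:R * (4 + r%:R) / (n%:R - 1) - (2 * m%:R / (n%:R - 1)) ^+ 2.
Proof.
split; first exact: line_regular_eligible hr.
have n1 : 0 < n%:R - 1 :> R by rewrite subr_gt0 ltr1n.
have varE (A : 'M[R]_n) : SLs G A -> variance A =
    \tr (A *m A) / (n%:R - 1) - (2 * m%:R / (n%:R - 1)) ^+ 2.
  move=> [SLA trA]; have [symA _ _ _] := SLA.
  by rewrite (variance_trace hn symA (SL_root0 (ltnW hn) SLA)) trA hG.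
have SLsL : SLs G (laplacian R G).
  by split; [exact: laplacian_SL|exact: mxtrace_laplacian].
have varL : variance (laplacian R G) =
    m%:R * (4 + r%:R) / (n%:R - 1) - (2 * m%:R / (n%:R - 1)) ^+ 2.
  by rewrite varE // (mxtrace_laplacian_sqr _ hr) hG.
have lbv : lbound [set variance A | A in SLs (R := R) G]%classic
    (variance (laplacian R G)).
  move=> _ [A SLsA <-]; rewrite varL varE // lerD2r ler_pM2r ?invr_gt0 //.
  by rewrite -hG; exact: mxtrace_sqr_ge hr SLsA.
rewrite -varL; apply/eqP; rewrite eq_le; apply/andP; split.
  by apply: ge_inf; [exists (variance (laplacian R G))|exists (laplacian R G)].
by apply: lb_le_inf lbv; exists (variance (laplacian R G)), (laplacian R G).
Qed.
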